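(* Let $G$ and $H$ be permutation groups on finite sets $\Gamma$ and $\Delta$ respectively, with $H$ transitive. If the wreath product $G\wr H$ in its product action is pre-primitive, then $G$ is pre-primitive.
   Context: A permutation group on $\Omega$ is a subgroup of $\mathrm{Sym}(\Omega)$. A partition of $\Omega$ is $G$-invariant if every $g\in G$ maps each part onto a part. The orbit partition of a subgroup is the partition of $\Omega$ into its orbits. A transitive permutation group $G$ on a finite set $\Omega$ is pre-primitive if every $G$-invariant partition of $\Omega$ is the orbit partition of some subgroup of $G$ (so a pre-primitive group is in particular transitive). The wreath product $G\wr H$ in its product action is the permutation group on the Cartesian product of $|\Delta|$ copies of $\Gamma$ (words over the alphabet $\Gamma$ with positions indexed by $\Delta$) generated by: the base group, a direct product of copies $G_\delta$ of $G$ indexed by $\delta\in\Delta$, where $G_\delta$ acts as $G$ on the symbol in position $\delta$ and fixes the symbols in other positions; and the top group $H$, acting by permuting the coordinates as it permutes $\Delta$. *)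

(* Defs.v *)
From HB Require Import structures.
From mathcomp Require Import all_boot all_fingroup.

Set Implicit Arguments.
Unset Strict Implicit.
Unset Printing Implicit Defensive.

Local Open Scope group_scope.

Definition invariant_partition (T : finType) (G : {group {perm T}})
    (P : {set {set T}}) : bool :=
  partition P [set: T] && [acts G, on P | 'P^*].

Definition orbits_of (T : finType) (K : {group {perm T}}) : {set {set T}} :=
  orbit 'P K @: [set: T].

(* [transitive G, on S | to] is false when S is empty, so a pre-primitive
   group acts on a nonempty set. *)
Definition preprimitive (T : finType) (G : {group {perm T}}) : Prop :=
  [transitive G, on [set: T] | 'P] /\
  forall P : {set {set T}}, invariant_partition G P ->
    exists2 K : {group {perm T}}, K \subset G & P = orbits_of K.

Section ProductAction.

Variables Gamma Delta : finType.
Implicit Types (w : {ffun Delta -> Gamma}) (d : Delta).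
Implicit Types (g : {perm Gamma}) (h : {perm Delta}).

Definition base_fun d g w : {ffun Delta -> Gamma} :=
  [ffun i => if i == d then g (w i) else w i].

Lemma base_fun_inj d g : injective (base_fun d g).
Proof.
move=> w1 w2 /ffunP eq_w; apply/ffunP=> i; have := eq_w i.
by rewrite !ffunE; case: eqP => // _ /perm_inj.
Qed.

Definition base_perm d g : {perm {ffun Delta -> Gamma}} :=
  perm (@base_fun_inj d g).

(* The symbol in position i of w is moved to position h i. *)
Definition top_fun h w : {ffun Delta -> Gamma} := [ffun i => w (h^-1 i)].

Lemma top_fun_inj h : injective (top_fun h).
Proof.
move=> w1 w2 /ffunP eq_w; apply/ffunP=> i; have := eq_w (h i).
by rewrite !ffunE permK.
Qed.

Definition top_perm h : {perm {ffun Delta -> Gamma}} := perm (@top_fun_inj h).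

Definition wreath_product (G : {group {perm Gamma}})
    (H : {group {perm Delta}}) : {group {perm {ffun Delta -> Gamma}}} :=
  <<[set base_perm d g | d : Delta, g : {perm Gamma} in G]
      :|: [set top_perm h | h in H]>>%G.

End ProductAction.

(* Main.v *)
Require Import Defs.
From HB Require Import structures.
From mathcomp Require Import all_boot all_fingroup.

Set Implicit Arguments.
Unset Strict Implicit.
Unset Printing Implicit Defensive.

Local Open Scope group_scope.

(** Everything rests on the shape of the elements of the wreath product: such
    an element k reads off the symbol in position i of k w as g (w j), where
    g in G and the position j depend on k and i but not on w
    ([wreath_product_coord]).

    A G-invariant partition P of Gamma lifts to words, two words being
    equivalent when they have P-equivalent symbols in every position. By the
    shape of its elements the wreath product preserves this relation, so
    pre-primitivity makes its classes the orbits of a subgroup K.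

    If a and b lie in one part of P, some k in K maps the constant word a to
    the constant word b. Fix a position i and let g be the element of G that
    k applies there. On a constant word it does not matter from which
    position the symbol is read: hence g a = b and, since k maps the constant
    word x to an equivalent word, g x is P-equivalent to x for all x. So g
    belongs to the kernel of G acting on P, and this kernel is therefore
    transitive on each part: its orbits are the parts of P. Transitivity of G
    also follows by comparing constant words. Transitivity of H is what ensures
    that there is a position to look at. *)

Section InvariantPartitions.

Variable T : finType.
Implicit Types (G : {group {perm T}}) (P : {set {set T}}).

Lemma mem_setact_perm (B : {set T}) (g : {perm T}) x :
  x \in B -> g x \in 'P^*%act B g.
Proof. by move=> Bx; apply/imsetP; exists x. Qed.

Lemma pblock_invariant G P g x y :
    invariant_partition G P -> g \in G ->
  pblock P x = pblock P y -> pblock P (g x) = pblock P (g y).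
Proof.
case/andP=> partP actP Gg Pxy; have [/eqP coverP tiP _] := and3P partP.
have Px: pblock P x \in P by rewrite pblock_mem ?coverP ?inE.
have Pgx: 'P^*%act (pblock P x) g \in P by rewrite (acts_act actP).
have inPgx z: pblock P z = pblock P x -> g z \in 'P^*%act (pblock P x) g.
  by move=> <-; rewrite mem_setact_perm ?mem_pblock ?coverP ?inE.
by rewrite (def_pblock tiP Pgx (inPgx x erefl)) (def_pblock tiP Pgx (inPgx y _)).
Qed.

Lemma preim_partition_invariant (rT : eqType) (f : T -> rT) G :
    (forall (g : {perm T}) x y, g \in G -> f x = f y -> f (g x) = f (g y)) ->
  invariant_partition G (preim_partition f [set: T]).
Proof.
move=> fG; rewrite /invariant_partition preim_partitionP /=.
apply/actsP=> g Gg B.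
(* One inclusion suffices for every group element, as it also applies to the
   inverse. *)
suffices stable h C: h \in G -> C \in preim_partition f [set: T] ->
    'P^*%act C h \in preim_partition f [set: T].
  by apply/idP/idP=> [/(stable g^-1) | /stable]; rewrite ?groupV ?actK; exact.
move=> Gh /imsetP[x _ ->]; apply/imsetP; exists (h x); rewrite ?inE //.
apply/setP=> y; rewrite !inE /=; apply/imsetP/eqP=> [[z] | fhxy].
  by rewrite !inE /= => /eqP fxz ->; apply: fG.
exists (h^-1 y); last by rewrite /= /aperm permKV.
by rewrite !inE /= -{1}(permK h x); apply/eqP/fG; rewrite ?groupV.
Qed.

(** A partition is determined by the relation of lying in the same part, so
    comparing it with an orbit partition amounts to comparing relations. *)
Lemma partition_orbitsP P (K : {group {perm T}}) :
    partition P [set: T] ->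
  P = orbits_of K <->
    forall x y, pblock P x = pblock P y <-> exists2 k, k \in K & k x = y.
Proof.
move=> partP; have [/eqP coverP tiP P0] := and3P partP.
have Pmem x: pblock P x \in P by rewrite pblock_mem ?coverP ?inE.
have memP x: x \in pblock P x by rewrite mem_pblock coverP inE.
have sameP x y: pblock P x = pblock P y <-> y \in pblock P x.
  split=> [-> // | ]; last by move/(def_pblock tiP (Pmem x)).
have orbP x y: y \in orbit 'P K x <-> exists2 k, k \in K & k x = y.
  by split=> [/orbitP | ] [k Kk kx]; [exists k | apply/orbitP; exists k].
split=> [defP x y | defK].
  have Px: orbit 'P K x \in P by rewrite defP imset_f ?inE.
  apply: iff_trans (sameP x y) _.
  by rewrite (def_pblock tiP Px (orbit_refl _ _ _)).
have pblockE x: pblock P x = orbit 'P K x.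
  by apply/setP=> y; apply/idP/idP=> [/sameP/defK/orbP | /orbP/defK/sameP].
apply/setP=> B; apply/idP/imsetP=> [PB | [x _ ->]]; last by rewrite -pblockE.
have [x Bx]: exists x, x \in B by apply/set0Pn; apply: contraNneq P0 => <-.
by exists x; rewrite ?inE // -pblockE (def_pblock tiP PB Bx).
Qed.

End InvariantPartitions.

Section WreathProduct.

Variables Gamma Delta : finType.
Variables (G : {group {perm Gamma}}) (H : {group {perm Delta}}).
Implicit Types (k : {perm {ffun Delta -> Gamma}}) (i j : Delta).

(** The generators have this property and it passes to products; the group
    being finite, every element is a product of generators, without inverses. *)
Lemma wreath_product_coord k i : k \in wreath_product G H ->
  exists2 g, g \in G & exists j, forall w, k w i = g (w j).
Proof.
case/gen_prodgP=> n [c genc ->] {k}; elim: n => [|n IHn] in c genc i *.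
  rewrite big_ord0; exists 1; rewrite ?group1 //.
  by exists i => w; rewrite !perm1.
rewrite big_ord_recr /=.
have [g Gg [j cnE]]: exists2 g, g \in G &
    exists j, forall w, c ord_max w i = g (w j).
  case/setUP: (genc ord_max) => [/imset2P[d g _] | /imsetP[h _ ->]].
    move=> Gg ->; exists (if i == d then g else 1).
      by case: ifP; rewrite ?group1.
    by exists i => w; rewrite permE ffunE; case: ifP; rewrite ?perm1.
  exists 1; rewrite ?group1 //.
  by exists (h^-1 i) => w; rewrite permE ffunE perm1.
have [|g1 Gg1 [j1 prodE]] := IHn (fun m => c (widen_ord (leqnSn n) m)) _ j.
  by move=> m; apply: genc.
by exists (g1 * g); rewrite ?groupM //; exists j1 => w; rewrite !permM cnE prodE.
Qed.

Definition word_class (P : {set {set Gamma}}) (w : {ffun Delta -> Gamma}) :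
  {ffun Delta -> {set Gamma}} := [ffun i => pblock P (w i)].

Lemma word_partition_invariant P : invariant_partition G P ->
  invariant_partition (wreath_product G H)
    (preim_partition (word_class P) [set: {ffun Delta -> Gamma}]).
Proof.
move=> invP; apply: preim_partition_invariant => k w1 w2 Wk /ffunP eqP.
apply/ffunP=> i; have [g Gg [j kE]] := wreath_product_coord i Wk.
rewrite !ffunE !kE; apply: (pblock_invariant invP Gg).
by have := eqP j; rewrite !ffunE.
Qed.

End WreathProduct.

Lemma pblock_preim_partition (T : finType) (rT : eqType) (f : T -> rT) x y :
  pblock (preim_partition f [set: T]) x = pblock (preim_partition f [set: T]) y
    <-> f x = f y.
Proof.
have /and3P[/eqP coverP tiP _] := preim_partitionP f [set: T].
have fE: (y \in pblock (preim_partition f [set: T]) x) = (f x == f y).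
  by rewrite pblock_equivalence_partition ?inE //; split=> // /eqP->.
split=> /eqP eqxy; apply/eqP; move: eqxy;
  by rewrite eq_pblock ?coverP ?inE // fE.
Qed.

Theorem theorem2p16 (Gamma Delta : finType)
    (G : {group {perm Gamma}}) (H : {group {perm Delta}}) :
  [transitive H, on [set: Delta] | 'P] ->
  preprimitive (wreath_product G H) ->
  preprimitive G.
Proof.
case/imsetP=> i _ _ [trW orbW].
pose cst x : {ffun Delta -> Gamma} := [ffun=> x].
split=> [|P invP].
  have [w0 _ _] := imsetP trW; apply/imsetP; exists (w0 i); rewrite ?inE //.
  apply/esym/setP=> b; rewrite inE; apply/orbitP.
  have [k Wk cab] := atransP2 trW (in_setT (cst (w0 i))) (in_setT (cst b)).
  have [g Gg [j kE]] := wreath_product_coord i Wk.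
  by exists g => //; have /ffunP/(_ i) := cab; rewrite /= /aperm kE !ffunE => ->.
have [partP _] := andP invP; have [/eqP coverP tiP _] := and3P partP.
exists ('C_G(P | 'P^*))%G; first exact: subsetIl.
apply/(partition_orbitsP _ partP) => a b; split=> [Pab | [g]]; last first.
  case/setIP=> _ /astabP fixP <-.
  have Pa: pblock P a \in P by rewrite pblock_mem ?coverP ?inE.
  apply/esym/(def_pblock tiP Pa); rewrite -(fixP _ Pa).
  by rewrite mem_setact_perm ?mem_pblock ?coverP ?inE.
have [K sKW defK] := orbW _ (word_partition_invariant (Delta := Delta) H invP).
have {}defK w1 w2: word_class P w1 = word_class P w2 <->
    exists2 k, k \in K & k w1 = w2.
  apply: iff_trans (iff_sym (pblock_preim_partition _ _ _)) _.
  by move: w1 w2; apply/partition_orbitsP=> //; apply: preim_partitionP.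
have [k Kk cab]: exists2 k, k \in K & k (cst a) = cst b.
  by apply/defK/ffunP=> d; rewrite !ffunE.
have [g Gg [j kE]] := wreath_product_coord i (subsetP sKW k Kk).
have kcstE x: k (cst x) i = g x by rewrite kE ffunE.
exists g; last by rewrite -kcstE cab ffunE.
have fixg x: pblock P (g x) = pblock P x.
  have /defK/ffunP/(_ i): exists2 k', k' \in K & k' (cst x) = k (cst x).
    by exists k.
  by rewrite !ffunE kcstE.
rewrite inE Gg; apply/astabP=> B PB.
(* A permutation that maps a finite set into itself maps it onto itself. *)
apply/eqP; rewrite eqEcard card_setact leqnn andbT.
apply/subsetP=> _ /imsetP[x Bx ->]; rewrite /= /aperm.
by rewrite -(def_pblock tiP PB Bx) -fixg mem_pblock coverP inE.
Qed.
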